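(* Let $n\geq 4$. Among the $n$-vertex trees, the path $P_n$ has the maximal total-eccentricity index; that is, for every $n$-vertex tree $T$ we have $\tau(T)\leq \tau(P_n)$.
   Context: All graphs are finite and simple. For a connected graph $G$, the eccentricity $e_G(v)$ of a vertex $v$ is the largest distance from $v$ to any other vertex of $G$, where distance is the length of a shortest path. The total-eccentricity index of $G$ is $\tau(G)=\sum_{u\in V(G)} e_G(u)$. $P_n$ denotes the path on $n$ vertices. *)

(* Defs.v *)
From mathcomp Require Import all_boot.
Set Implicit Arguments.
Unset Strict Implicit.
Unset Printing Implicit Defensive.

Record sgraph := SGraph {
  vertex :> finType;
  edge : rel vertex;
  edge_sym : symmetric edge;
  edge_irrefl : irreflexive edge }.

(* A path u = x_0, x_1, ..., x_k = v is given by u and the k-tuple p of the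
   vertices x_1, ..., x_k. *)
Definition has_path (G : sgraph) (u v : G) (k : nat) : bool :=
  [exists p : k.-tuple G,
    [&& path (@edge G) u p, last u p == v & uniq (u :: p)]].

(* The least length k of a path from u to v.  A path has at most #|G| vertices,
   so only k < #|G| need be searched; the value is #|G| when there is no path
   from u to v. *)
Definition dist (G : sgraph) (u v : G) : nat :=
  find (has_path u v) (iota 0 #|G|).

Definition eccentricity (G : sgraph) (u : G) : nat :=
  \max_(v : G | v != u) dist u v.

Definition total_eccentricity (G : sgraph) : nat :=
  \sum_(u : G) eccentricity u.

Definition connected (G : sgraph) : Prop :=
  0 < #|G| /\ forall u v : G, connect (@edge G) u v.

(* The bound on the size matters: ucycle also holds for the empty sequence and
   for [:: x; y] when x and y are adjacent. *)
Definition acyclic (G : sgraph) : Prop :=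
  forall c : seq G, 3 <= size c -> ~ ucycle (@edge G) c.

Definition is_tree (G : sgraph) : Prop := connected G /\ acyclic G.

Definition path_edge (n : nat) : rel 'I_n :=
  fun i j => (i.+1 == j :> nat) || (j.+1 == i :> nat).

Lemma path_edge_sym n : symmetric (@path_edge n).
Proof. by move=> i j; rewrite /path_edge orbC. Qed.

Lemma path_edge_irrefl n : irreflexive (@path_edge n).
Proof. by move=> i; rewrite /path_edge orbb gtn_eqF. Qed.

Definition path_graph (n : nat) : sgraph :=
  SGraph (@path_edge_sym n) (@path_edge_irrefl n).

(* Main.v *)
Require Import Defs.
From mathcomp Require Import all_boot.
Set Implicit Arguments.
Unset Strict Implicit.
Unset Printing Implicit Defensive.

(** The eccentricities of a connected graph [G] on [n] vertices can be compared
    with those of [P_n] one vertex at a time.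

    Let [x_0, ..., x_d] be a longest simple path of [G].  A vertex [v] can be
    joined to it by a simple path that starts at some [x_j] and never meets the
    long path again; let [h] be its length.  Following [x_0, ..., x_j] and then
    this branch is again simple, so [j + h <= d], and likewise [d - j + h <= d].
    Going from [x_i] to [x_j] and then along the branch shows that [v] is within
    [d - i] of [x_i] when [i <= j], and within [i] when [j <= i].  Therefore
    [x_i] has eccentricity at most [maxn i (d - i)]
    ([eccentricity_on_longest_path]).  All other vertices have eccentricity at
    most [d], because shortest paths are simple.

    Now list the vertices of [G] with [x_0, ..., x_d] first and the others
    after them in any order.  The vertex in position [i] has eccentricity at
    most [maxn i (n.-1 - i)]: for [i <= d] because [d <= n.-1], and for [i > d]
    because [d <= i] ([eccentricity_enumeration]).  In [P_n] the vertex [i] is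
    at distance [i] from one end and [n.-1 - i] from the other, so its
    eccentricity is at least that bound ([path_graph_eccentricity_ge]).  Adding
    up over [i] gives the inequality. *)

(** * Distance and eccentricity *)

Section Distance.
Variable G : sgraph.
Implicit Types (u v w z : G) (p q s : seq G).

Lemma dist_le_walk u p : path (@edge G) u p -> dist u (last u p) <= size p.
Proof.
move=> up; case/shortenP: up => q uq uniq_q sub_qp.
have lt_q : size q < #|G|.
  by have := max_card (mem (u :: q)); rewrite (card_uniqP uniq_q).
have le_qp : size q <= size p.
  by apply: uniq_leq_size sub_qp; case/andP: uniq_q.
apply: leq_trans le_qp; rewrite /dist leqNgt; apply/negP => /(before_find 0).
rewrite nth_iota // add0n /has_path; move/negbT/negP; apply.
by apply/existsP; exists (in_tuple q); rewrite uq eqxx.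
Qed.

(** The hypothesis [k <= #|G|] is there because [#|G|] is the value of [dist]
    when no path exists. *)
Lemma dist_ge u v k :
    k <= #|G| -> (forall p, path (@edge G) u p -> last u p = v -> k <= size p) ->
  k <= dist u v.
Proof.
move=> le_kG walk_ge; rewrite /dist.
case: (boolP (has (has_path u v) (iota 0 #|G|))) => [has_uv | no_uv].
  have := nth_find 0 has_uv; rewrite nth_iota ?add0n; last first.
    by move: has_uv; rewrite has_find size_iota.
  case/existsP => p /and3P [up /eqP uv _].
  by rewrite -[X in _ <= X](size_tuple p) walk_ge.
by rewrite hasNfind // size_iota.
Qed.

Lemma eccentricity_le u k :
  (forall v, dist u v <= k) -> eccentricity u <= k.
Proof. by move=> le_k; apply/bigmax_leqP => v _. Qed.

Lemma dist_le_eccentricity u v : v != u -> dist u v <= eccentricity u.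
Proof. by move=> neq_vu; rewrite /eccentricity (bigD1 v) //= leq_maxl. Qed.

End Distance.

(** * Eccentricities along a longest path *)

Section LongestPath.
Variable G : sgraph.
Hypothesis connG : connected G.
Implicit Types (u v w z : G) (m p q s : seq G).

Definition simple_path s := sorted (@edge G) s && uniq s.

Definition longest_path m :=
  simple_path m /\ forall s, simple_path s -> size s <= size m.

Lemma simple_path_rev s : simple_path (rev s) = simple_path s.
Proof.
rewrite /simple_path rev_uniq rev_sorted; congr (_ && _).
by case: s => //= x s; apply: eq_path => u v; rewrite edge_sym.
Qed.

Lemma simple_path_joining u v :
  exists p, [/\ path (@edge G) u p, uniq (u :: p) & last u p = v].
Proof.
have [p up ->] := connectP (connG.2 u v).
by case/shortenP: up => q uq uniq_q _; exists q.
Qed.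

Lemma longest_path_exists : exists m, longest_path m.
Proof.
pose has_length k := [exists s : k.-tuple G, simple_path s].
have size0 : has_length 0 by apply/existsP; exists [tuple].
have bounded k : has_length k -> k <= #|G|.
  case/existsP => s /andP [_ /card_uniqP].
  by rewrite size_tuple => <-; apply: max_card.
have exP : exists k, has_length k by exists 0.
case: (ex_maxnP exP bounded) => k /existsP [m simple_m] max_k.
exists m; split=> // s simple_s; rewrite size_tuple max_k //.
by apply/existsP; exists (in_tuple s).
Qed.

(** Cut a path to [v] at its last vertex in [m]. *)
Lemma branch_from (m : seq G) v : m != [::] ->
  exists z q, [/\ z \in m, path (@edge G) z q, uniq q, last z q = v
                & ~~ has (mem m) q].
Proof.
case: m => // x m _; set M := x :: m.
have [p] := simple_path_joining x v.
have : has (mem M) (x :: p) by rewrite /= mem_head.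
(* The start of the path moves along it; the [x] inside [M] stays. *)
elim: p {1 2 3 4}x => [|a p IHp] y hitM [yp uniq_p last_p].
  by exists y, [::]; split=> //; move: hitM; rewrite /= orbF.
have [hit_p | miss_p] := boolP (has (mem M) (a :: p)).
  by apply: (IHp a hit_p); case/andP: yp => _ ap; case/andP: uniq_p.
exists y, (a :: p); split=> //; last by case/andP: uniq_p.
by move: hitM; rewrite [has _ _]/= -/(has _ (a :: p)) (negPf miss_p) orbF.
Qed.

(** If a branch leaves a longest path [a ++ w :: c] at or after [w], replacing
    the part of [c] behind the branching point [z] by the branch cannot lengthen
    the path; so walking from [w] along [c] to [z] and then along the branch
    takes at most [size c] steps. *)
Lemma dist_along_branch a w c z q :
    longest_path (a ++ w :: c) -> z \in w :: c ->
    path (@edge G) z q -> uniq q -> ~~ has (mem (a ++ w :: c)) q ->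
  dist w (last z q) <= size c.
Proof.
move=> [/andP [sorted_m uniq_m] longest] zc zq uniq_q disj.
case/splitPl: zc sorted_m uniq_m longest disj => c1 c2 z_c1.
rewrite -cat_cons catA => sorted_m uniq_m longest disj.
have detour : simple_path ((a ++ w :: c1) ++ q).
  apply/andP; split.
    have := cat_sorted2 sorted_m => -[+ _].
    case: (a) => [|b a'] /=; first by rewrite cat_path z_c1 zq => ->.
    by rewrite !cat_path /= last_cat /= z_c1 zq => ->.
  move: uniq_m disj; rewrite !(cat_uniq (a ++ _)) uniq_q => /and3P [-> _ _].
  rewrite andbT => /hasPn disj; apply/hasPn => y yq.
  by have := disj y yq; rewrite /= mem_cat negb_or => /andP [].
have le_q : size q <= size c2.
  by have := longest _ detour; rewrite !(size_cat (a ++ _)) leq_add2l.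
have w_walk : path (@edge G) w (c1 ++ q).
  have := cat_sorted2 sorted_m => -[/cat_sorted2 [_ /= w_c1] _].
  by rewrite cat_path w_c1 z_c1.
have := dist_le_walk w_walk; rewrite last_cat z_c1 => /leq_trans; apply.
by rewrite !size_cat leq_add2l.
Qed.

(** The branch to any vertex leaves either at or after [w], or before it; the
    second case is the first one read along the reversed path. *)
Lemma eccentricity_on_longest_path a w c :
  longest_path (a ++ w :: c) -> eccentricity w <= maxn (size a) (size c).
Proof.
move=> longest; apply: eccentricity_le => v.
have [|z [q [z_m zq uniq_q <- disj]]] := @branch_from (a ++ w :: c) v.
  by case: (a).
have [z_c | z_notc] := boolP (z \in w :: c).
  by rewrite leq_max (dist_along_branch longest) ?orbT.
have z_a : z \in w :: rev a.
  by move: z_m; rewrite mem_cat (negPf z_notc) orbF inE mem_rev orbC => ->.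
have rev_m : rev (a ++ w :: c) = rev c ++ w :: rev a.
  by rewrite rev_cat rev_cons cat_rcons.
have longest_rev : longest_path (rev c ++ w :: rev a).
  rewrite -rev_m; case: longest => simple_m longest.
  by split=> [|s]; rewrite ?simple_path_rev ?size_rev //; apply: longest.
rewrite leq_max -[X in _ <= X](size_rev a) (dist_along_branch longest_rev) //.
by rewrite -rev_m; apply: contra disj => /hasP [y yq /= ym];
  apply/hasP; exists y; rewrite //= -mem_rev.
Qed.

Lemma eccentricity_lt_longest_path m u :
  longest_path m -> eccentricity u < size m.
Proof.
case=> _ longest.
have bound v : dist u v < size m.
  have [p [up uniq_p <-]] := simple_path_joining u v.
  have := longest (u :: p); rewrite /simple_path /= up.
  by move/(_ uniq_p); apply: leq_ltn_trans; apply: dist_le_walk.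
have m_gt0 : 0 < size m by apply: leq_ltn_trans (bound u).
by rewrite -(prednK m_gt0) ltnS; apply: eccentricity_le => v;
  rewrite -ltnS prednK.
Qed.

(** The list starts with a longest path, whose vertices obey
    [eccentricity_on_longest_path]; a later position [i] is at least the number
    of vertices of that path, so [i] alone bounds the eccentricity there. *)
Lemma eccentricity_enumeration :
  exists2 l, perm_eq l (enum G) &
    forall x i, i < #|G| -> eccentricity (nth x l i) <= maxn i (#|G|.-1 - i).
Proof.
have [m longest] := longest_path_exists.
have [/andP [_ uniq_m] _] := longest.
pose l := m ++ [seq u <- enum G | u \notin m].
have perm_l : perm_eq l (enum G).
  apply: uniq_perm (enum_uniq _) _.
    rewrite cat_uniq uniq_m filter_uniq ?enum_uniq // andbT.
    by apply/hasPn => u; rewrite mem_filter => /andP [].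
  by move=> u; rewrite mem_cat mem_filter mem_enum andbT orbN.
exists l => // x i lt_i.
have [lt_im | le_mi] := ltnP i (size m); last first.
  rewrite leq_max; apply/orP; left.
  by apply: leq_trans le_mi; apply/ltnW/eccentricity_lt_longest_path.
rewrite nth_cat lt_im; have := longest.
rewrite -{1}(cat_take_drop i m) (drop_nth x lt_im).
move/eccentricity_on_longest_path/leq_trans; apply.
have le_mG : size m <= #|G| by rewrite -(card_uniqP uniq_m) max_card.
rewrite size_takel ?(ltnW lt_im) // size_drop -add1n subnDA subn1.
by rewrite geq_max leq_maxl leq_max leq_sub2r ?orbT // -!subn1 leq_sub2r.
Qed.

End LongestPath.

(** * The path graph *)

Section PathGraph.
Variable n : nat.

(** Each step of a walk changes the position by one, so a walk is at least as
    long as the difference of the positions of its ends. *)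
Lemma path_graph_walk_ge (u : path_graph n) p : path (@path_edge n) u p ->
  (u <= last u p + size p) && (last u p <= u + size p).
Proof.
elim: p u => [|a p IHp] u /=; first by rewrite addn0 leqnn.
case/andP => ua /IHp /andP [le1 le2]; rewrite !addnS.
case/orP: ua => /eqP ua.
  move: le1 le2; rewrite -ua addSn => le1 ->; rewrite andbT.
  exact: leq_trans (ltnW le1) (leqnSn _).
rewrite -ua ltnS le1 addSn (leq_trans le2) //.
exact: leq_trans (leqnSn _) (leqnSn _).
Qed.

Lemma path_graph_eccentricity_ge (i : path_graph n) :
  maxn i (n.-1 - i) <= eccentricity i.
Proof.
have n_gt0 : 0 < n by apply: leq_ltn_trans (ltn_ord i).
have le_n1 : n.-1 < n by rewrite prednK.
rewrite geq_max; apply/andP; split.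
  have [->|i_gt0] := posnP i; first by [].
  have neq : Ordinal n_gt0 != i by rewrite -val_eqE /= eq_sym -lt0n.
  apply: leq_trans (@dist_le_eccentricity (path_graph n) _ _ neq).
  apply: dist_ge => [|p ip last_p]; first by rewrite card_ord ltnW.
  by have /andP [] := path_graph_walk_ge ip; rewrite last_p.
have [->|gap] := posnP (n.-1 - i); first by [].
have neq : Ordinal le_n1 != i.
  by rewrite -val_eqE /= gtn_eqF // -subn_gt0.
apply: leq_trans (@dist_le_eccentricity (path_graph n) _ _ neq).
apply: dist_ge => [|p ip last_p].
  by rewrite card_ord (leq_trans (leq_subr _ _)) // ltnW.
by have /andP [_] := path_graph_walk_ge ip; rewrite last_p /= leq_subLR.
Qed.

Lemma path_graph_connected : 0 < n -> connected (path_graph n).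
Proof.
move=> n_gt0; split; first by rewrite card_ord.
have from0 k (lt_kn : k < n) :
    connect (@path_edge n) (Ordinal n_gt0) (Ordinal lt_kn).
  elim: k lt_kn => [|k IHk] lt_kn.
    by rewrite (_ : Ordinal lt_kn = Ordinal n_gt0) //; apply: val_inj.
  apply: connect_trans (IHk (ltnW lt_kn)) (connect1 _).
  by rewrite /path_edge /= eqxx.
have sym : connect_sym (@path_edge n).
  exact: sym_connect_sym (@path_edge_sym n).
move=> [u lt_u] [v lt_v]; apply: connect_trans (from0 v lt_v).
by rewrite /= sym.
Qed.

(** The largest vertex of a cycle has only one smaller neighbour, which would
    have to be both the next and the previous vertex. *)
Lemma path_graph_acyclic : acyclic (path_graph n).
Proof.
move=> c size_c cyc_c.
have [m m_c max_m] : exists2 m, m \in c & forall x, x \in c -> x <= m.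
  case: c size_c {cyc_c} => // x c _.
  case: (@arg_maxnP _ x (mem (x :: c)) (@nat_of_ord n)); first exact: mem_head.
  by move=> m m_c max_m; exists m.
have [k s rot_c] := rot_to m_c.
have max_s x : x \in m :: s -> x <= m by rewrite -rot_c mem_rot; apply: max_m.
move: size_c cyc_c; rewrite -(size_rot k) -(rot_ucycle k) rot_c.
case: s {rot_c} max_s => [|a [|b s]] // max_s _ /andP [].
rewrite (cycle_path m) /= => /andP [/orP last_m /andP [/orP m_a _]].
have eq_a : a.+1 = m.
  case: m_a => /eqP // ma.
  by have := max_s a; rewrite !inE eqxx orbT -ma ltnn => /(_ isT).
have last_in : last b s \in b :: s by apply: mem_last.
have eq_last : (last b s).+1 = m.
  case: last_m => /eqP // ml.
  by have := max_s (last b s); rewrite 2!in_cons last_in !orbT -ml ltnn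
    => /(_ isT).
have same : a = last b s by apply/val_inj/succn_inj; rewrite eq_last.
by case/and4P => _; rewrite same last_in.
Qed.

End PathGraph.

(** * The extremal inequality *)

Theorem theorem2p3 (n : nat) (hn : 4 <= n) :
  [/\ #|path_graph n| = n,
      is_tree (path_graph n)
    & forall T : sgraph, #|T| = n -> is_tree T ->
        total_eccentricity T <= total_eccentricity (path_graph n)].
Proof.
split; first exact: card_ord.
  split; last exact: path_graph_acyclic.
  by apply: path_graph_connected; apply: leq_trans hn.
move=> T card_T [connT _].
have [l perm_l ecc_l] := eccentricity_enumeration connT.
have /card_gt0P [x _] := connT.1.
rewrite /total_eccentricity -big_enum -(perm_big _ perm_l) (big_nth x).
rewrite (perm_size perm_l) -cardE card_T big_mkord.
apply: leq_sum => i _; apply: leq_trans (path_graph_eccentricity_ge i).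
by rewrite -[X in maxn _ (X.-1 - _)]card_T ecc_l // card_T.
Qed.
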